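(* For every $X \in \{\epsilon, \mathtt{S}, \mathtt{I}, \mathtt{D}, \mathtt{SI}, \mathtt{SD}, \mathtt{ID}, \mathtt{SID}\}$ and every formula $\phi$ of the language $\Phi$, the following statements are equivalent: (0) $\phi$ is valid with respect to the class of grand-coalition-first action $X$-models; (1) $\phi$ is valid with respect to the class of single-coalition-first action $X$-models; (2) $\phi$ is valid with respect to the class of single-coalition-first neighborhood $X$-models; (3) $\phi$ is valid with respect to the class of clear grand-coalition-first action $X$-models; (4) $\phi$ is valid with respect to the class of clear single-coalition-first neighborhood $X$-models; (5) $\phi$ is valid with respect to the class of tree-like grand-coalition-first action $X$-models; (6) $\phi$ is valid with respect to the class of tree-like single-coalition-first neighborhood $X$-models.
   Context: Setting. $AP$ is a countable set of atomic propositions and $AG$ a finite nonempty set of agents; subsets of $AG$ are coalitions. The language $\Phi$ is $\phi ::= \top \mid p \mid \neg\phi \mid (\phi\wedge\phi) \mid \langle C\rangle\phi$ with $p\in AP$, $C\subseteq AG$. $AC$ is a nonempty set of actions; $JA_C$ is the set of functions $\sigma_C: C\to AC$ (joint actions of $C$); for $D\subseteq C$, $\sigma_C|_D$ is the restriction. A formula is valid with respect to a class of models if it is true at every state of every model in the class. Grand-coalition-first action model: $(ST, AC, out_{AG}, lab)$ with $ST$ a nonempty set of states, $out_{AG}: ST\times JA_{AG}\to\mathcal P(ST)$, $lab: ST\to\mathcal P(AP)$. Derived: $out_C(s,\sigma_C)=\bigcup\{out_{AG}(s,\sigma_{AG}) \mid \sigma_C\subseteq\sigma_{AG}\}$; $av_C(s)=\{\sigma_C\in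 JA_C \mid out_C(s,\sigma_C)\neq\emptyset\}$; successor function $suc(s)=\bigcup\{out_{AG}(s,\sigma_{AG})\mid \sigma_{AG}\in JA_{AG}\}$. Single-coalition-first action model: $(ST, AC, suc, \{out_a\mid a\in AG\}, lab)$ with $suc: ST\to\mathcal P(ST)$ and, for each agent $a$, $out_a: ST\times JA_a\to\mathcal P(ST)$ such that $\bigcup\{out_a(s,\sigma_a)\mid\sigma_a\in JA_a\}=suc(s)$ for all $s$. Derived: $out_\emptyset(s,\emptyset)=suc(s)$; for nonempty $C$, $out_C(s,\sigma_C)=\bigcap\{out_a(s,\sigma_C|_a)\mid a\in C\}$; $av_C(s)=\{\sigma_C\mid out_C(s,\sigma_C)\neq\emptyset\}$. Action semantics (both kinds of action models): Boolean clauses as usual, $s\Vdash p$ iff $p\in lab(s)$, and $s\Vdash\langle C\rangle\phi$ iff there is $\sigma_C\in av_C(s)$ such that $t\Vdash\phi$ for all $t\in out_C(s,\sigma_C)$. An action model is serial if $av_C(s)\neq\emptyset$ for all $C,s$; independent if for all $s$ and disjoint $C,D$, $\sigma_C\in av_C(s)$ and $\sigma_D\in av_D(s)$ imply $\sigma_C\cup\sigma_D\in av_{C\cup D}(s)$; deterministic if $out_{AG}(s,\sigma_{AG})$ is a singleton for all $s$ and $\sigma_{AG}\in av_{AG}(s)$. Single-coalition-first neighborhood model: $(ST, suc, \{nei_a\mid a\in AG\}, lab)$ with $suc: ST\to\mathcal P(ST)$ and each $nei_a(s)\subseteq\mathcal P(ST)$ a cover of $suc(s)$ (its union is $suc(s)$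 and $\emptyset\notin nei_a(s)$). For families $\Delta_1,\Delta_2$ of nonempty sets, $\Delta_1\odot\Delta_2=\{Y_1\cap Y_2\mid Y_1\in\Delta_1,Y_2\in\Delta_2,Y_1\cap Y_2\neq\emptyset\}$, extended to finitely many families. Derived: $nei_C(s)=\emptyset$ if $suc(s)=\emptyset$; $nei_C(s)=\{suc(s)\}$ if $suc(s)\neq\emptyset$ and $C=\emptyset$; otherwise $nei_C(s)=\bigodot\{nei_a(s)\mid a\in C\}$. Semantics: $s\Vdash\langle C\rangle\phi$ iff there is $Y\in nei_C(s)$ with $t\Vdash\phi$ for all $t\in Y$ (other clauses as usual). Such a model is serial if $nei_C(s)\neq\emptyset$ for all $C,s$; independent if for all $s$, disjoint $C,D$, $Y_1\in nei_C(s)$, $Y_2\in nei_D(s)$, $Y_1\cap Y_2\neq\emptyset$; deterministic if every $Y\in nei_{AG}(s)$ is a singleton. For $X$ a string over $\{\mathtt S,\mathtt I,\mathtt D\}$ (with $\epsilon$ the empty string), an $X$-model is a model having the properties seriality ($\mathtt S$), independence ($\mathtt I$), determinism ($\mathtt D$) named in $X$. Clear: a grand-coalition-first action model is clear if for all $s$ and $\sigma_{AG}\neq\sigma'_{AG}$, $out_{AG}(s,\sigma_{AG})\cap out_{AG}(s,\sigma'_{AG})=\emptyset$; a single-coalition-first neighborhood model is clear if every $nei_a(s)$ is a partition of $suc(s)$. Tree-like: in an action model, a $C$-history from $s_0$ to $s_n$ is a sequence $(s_0,\sigma^1_C,s_1,\dots,\sigma^n_C,s_n)$ with $\sigma^{i+1}_C\in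 av_C(s_i)$ and $s_{i+1}\in out_C(s_i,\sigma^{i+1}_C)$ (the single state $s$ counts as a $C$-history from $s$ to $s$); a grand-coalition-first action model is tree-like if there is a root $r$ such that for every state $s$ there is a unique $AG$-history from $r$ to $s$. In a single-coalition-first neighborhood model, a $C$-history is $(s_0,Y_1,s_1,\dots,Y_n,s_n)$ with $Y_{i+1}\in nei_C(s_i)$ and $s_{i+1}\in Y_{i+1}$ (again $s$ alone is a history from $s$ to $s$); the model is tree-like if there is $r$ such that for every agent $a$ and every state $s$ there is a unique $a$-history from $r$ to $s$. *)

(* Defs.v *)
(* Two kinds of sets occur: coalitions are finite sets [{set AG}] of MathComp,
   sets of states are sets [set ST] of [classical_sets]. *)
From HB Require Import structures.
From mathcomp Require Import all_boot.
From mathcomp Require Import boolp classical_sets.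
Set Implicit Arguments.
Unset Strict Implicit.
Unset Printing Implicit Defensive.
Local Open Scope classical_set_scope.

Inductive formula (AP : countType) (AG : finType) : Type :=
| FTop
| FAtom of AP
| FNeg of formula AP AG
| FAnd of formula AP AG & formula AP AG
| FCan of {set AG} & formula AP AG.
Arguments FTop {AP AG}.
Arguments FAtom {AP AG} _.

(* The letters S, I, D; a string over them is a [seq feature]. *)
Inductive feature : Type := Ser | Ind | Det.

Definition feature_eqb (x y : feature) : bool :=
  match x, y with
  | Ser, Ser | Ind, Ind | Det, Det => true
  | _, _ => false
  end.
Lemma feature_eqP : Equality.axiom feature_eqb.
Proof. by case; case; constructor. Qed.
HB.instance Definition _ := hasDecEq.Build feature feature_eqP.

Section JointActions.
Variables (AG : finType) (AC : Type).
Implicit Types C D : {set AG}.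

Definition JA C : Type := {ffun {a : AG | a \in C} -> AC}.

Definition restr C D (DC : D \subset C) (sigma : JA C) : JA D :=
  [ffun a : {a : AG | a \in D} =>
     sigma (exist _ (val a) (fintype.subsetP DC (val a) (valP a)))].

Lemma in_setU_right C D (a : AG) :
  a \in (C :|: D)%SET -> a \notin C -> a \in D.
Proof. by rewrite inE => /orP[->|]. Qed.

(* The union of two joint actions. On [C :&: D] it takes the value of [sigma],
   but it is only used for disjoint [C] and [D]. *)
Definition ja_union C D (sigma : JA C) (tau : JA D) : JA (C :|: D)%SET :=
  [ffun a : {a : AG | a \in (C :|: D)%SET} =>
     match boolP (val a \in C) with
     | AltTrue aC => sigma (exist _ (val a) aC)
     | AltFalse aC => tau (exist _ (val a) (in_setU_right (valP a) aC))
     end].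

End JointActions.

(* A history from [s0] is the list of its (label, next state) pairs. *)
Fixpoint is_history (ST L : Type) (step : ST -> L -> ST -> Prop)
    (s0 : ST) (h : seq (L * ST)) (s : ST) : Prop :=
  match h with
  | [::] => s0 = s
  | (l, s1) :: h' => step s0 l s1 /\ is_history step s1 h' s
  end.

(* The notions common to both kinds of action models, as functions of the
   family of all derived outcome functions [out C]. *)
Section ActionModels.
Variables (AP : countType) (AG : finType) (ST AC : Type).
Variable out : forall C : {set AG}, ST -> JA AC C -> set ST.
Variable lab : ST -> set AP.

Definition act_av (C : {set AG}) (s : ST) : set (JA AC C) :=
  [set sigma | out s sigma !=set0].

Fixpoint act_sat (phi : formula AP AG) (s : ST) : Prop :=
  match phi with
  | FTop => True
  | FAtom p => lab s p
  | FNeg psi => ~ act_sat psi s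
  | FAnd psi chi => act_sat psi s /\ act_sat chi s
  | FCan C psi => exists sigma : JA AC C,
      act_av s sigma /\ forall t, out s sigma t -> act_sat psi t
  end.

Definition act_serial : Prop :=
  forall (C : {set AG}) (s : ST), act_av (C := C) s !=set0.

Definition act_independent : Prop :=
  forall (s : ST) (C D : {set AG}), [disjoint C & D]%B ->
  forall (sigma : JA AC C) (tau : JA AC D),
    act_av s sigma -> act_av s tau -> act_av s (ja_union sigma tau).

Definition act_deterministic : Prop :=
  forall (s : ST) (sigma : JA AC [set: AG]%SET),
    act_av s sigma -> exists t, out s sigma = [set t].

Definition act_feature (f : feature) : Prop :=
  match f with
  | Ser => act_serial
  | Ind => act_independent
  | Det => act_deterministic
  end.

Definition act_history (C : {set AG}) :
    ST -> seq (JA AC C * ST) -> ST -> Prop :=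
  is_history (fun s (sigma : JA AC C) t => act_av s sigma /\ out s sigma t).

End ActionModels.

Section GrandCoalitionFirst.
Variables (AP : countType) (AG : finType).

Record gca_model : Type := GCAModel {
  gca_state : Type;
  gca_action : Type;
  gca_outAG : gca_state -> JA gca_action [set: AG]%SET -> set gca_state;
  gca_lab : gca_state -> set AP;
  gca_state_inh : inhabited gca_state;
  gca_action_inh : inhabited gca_action }.

Definition gca_out (M : gca_model) (C : {set AG}) (s : gca_state M)
    (sigma : JA (gca_action M) C) : set (gca_state M) :=
  \bigcup_(tau in [set tau | restr (finset.subsetT C) tau = sigma]) gca_outAG s tau.

Definition gca_sat (M : gca_model) : formula AP AG -> gca_state M -> Prop :=
  act_sat (@gca_out M) (@gca_lab M).

Definition gca_X_model (X : seq feature) (M : gca_model) : Prop :=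
  forall f, f \in X -> act_feature (@gca_out M) f.

Definition gca_clear (M : gca_model) : Prop :=
  forall (s : gca_state M) (sigma tau : JA (gca_action M) [set: AG]%SET),
    sigma <> tau -> gca_outAG s sigma `&` gca_outAG s tau = set0.

Definition gca_tree_like (M : gca_model) : Prop :=
  exists r : gca_state M, forall s : gca_state M,
    exists! h, act_history (@gca_out M) (C := [set: AG]%SET) r h s.

Definition gca_valid (K : gca_model -> Prop) (phi : formula AP AG) : Prop :=
  forall M, K M -> forall s : gca_state M, gca_sat phi s.

End GrandCoalitionFirst.

Section SingleCoalitionFirstAction.
Variables (AP : countType) (AG : finType).

Record sca_model : Type := SCAModel {
  sca_state : Type;
  sca_action : Type;
  sca_suc : sca_state -> set sca_state;
  sca_out1 : forall a : AG,
    sca_state -> JA sca_action [set a]%SET -> set sca_state;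
  sca_lab : sca_state -> set AP;
  sca_state_inh : inhabited sca_state;
  sca_action_inh : inhabited sca_action;
  sca_out1_suc : forall (a : AG) (s : sca_state),
    \bigcup_(sigma in [set: JA sca_action [set a]%SET]) sca_out1 s sigma
      = sca_suc s }.

Definition sca_out (M : sca_model) (C : {set AG}) (s : sca_state M)
    (sigma : JA (sca_action M) C) : set (sca_state M) :=
  if C == finset.set0 then sca_suc s
  else [set t | forall (a : AG) (aC : [set a]%SET \subset C),
                  sca_out1 s (restr aC sigma) t].

Definition sca_sat (M : sca_model) : formula AP AG -> sca_state M -> Prop :=
  act_sat (@sca_out M) (@sca_lab M).

Definition sca_X_model (X : seq feature) (M : sca_model) : Prop :=
  forall f, f \in X -> act_feature (@sca_out M) f.

Definition sca_valid (K : sca_model -> Prop) (phi : formula AP AG) : Prop :=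
  forall M, K M -> forall s : sca_state M, sca_sat phi s.

End SingleCoalitionFirstAction.

Section Odot.
Variables (AG : finType) (ST : Type).
Implicit Types (C : {set AG}) (Delta : AG -> set (set ST)).

Definition odot (D1 D2 : set (set ST)) : set (set ST) :=
  [set Y | Y !=set0 /\ exists Y1 Y2, [/\ D1 Y1, D2 Y2 & Y = Y1 `&` Y2]].

(* The extension of [odot] to the families [Delta a], [a] in a nonempty [C];
   see [bigodot1] and [bigodotU1]. *)
Definition bigodot C Delta : set (set ST) :=
  [set Y | Y !=set0 /\
     exists F : AG -> set ST,
       (forall a, a \in C -> Delta a (F a)) /\
       Y = \bigcap_(a in [set` C]) F a].

Lemma bigodot1 (a : AG) Delta :
  ~ Delta a set0 -> bigodot [set a]%SET Delta = Delta a.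
Proof.
move=> D0; apply/seteqP; split=> Y /=.
- move=> [_ [F [DF ->]]].
  have -> : [set` [set a]%SET] = [set a] :> set AG.
    by apply/seteqP; split=> x /=; rewrite inE => /eqP.
  by rewrite bigcap_set1; apply: DF; rewrite inE.
- move=> DY; split.
    by apply/set0P/negP => /eqP Y0; apply: D0; rewrite -Y0.
  exists (fun=> Y); split=> [b|]; first by rewrite inE => /eqP->.
  apply/seteqP; split=> t; first by move=> Yt b.
  by apply; rewrite /= inE.
Qed.

Lemma bigodotU1 (a : AG) C Delta : a \notin C ->
  bigodot (a |: C)%SET Delta = odot (Delta a) (bigodot C Delta).
Proof.
move=> aC; apply/seteqP; split=> Y /=.
- move=> [Y0 [F [DF YE]]]; split=> //.
  have YE' : Y = F a `&` \bigcap_(b in [set` C]) F b.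
    rewrite YE; apply/seteqP; split=> t /=.
      move=> Ft; split; first by apply: Ft; rewrite /= setU11.
      by move=> b /= bC; apply: Ft; rewrite /= setU1r.
    by move=> [Fa FC] b /=; rewrite !inE => /orP[/eqP->|/FC].
  exists (F a), (\bigcap_(b in [set` C]) F b); split=> //.
    by apply: DF; rewrite setU11.
  split; first by have [t] := Y0; rewrite YE' => -[_ ?]; exists t.
  by exists F; split=> // b bC; apply: DF; rewrite setU1r.
- move=> [Y0 [Y1 [Y2 [D1 [_ [F [DF Y2E]]] YE]]]]; split=> //.
  exists (fun b => if b == a then Y1 else F b); split.
    by move=> b; rewrite !inE; case: eqVneq => [->|_ /=] // /DF.
  rewrite YE Y2E; apply/seteqP; split=> t /=.
    move=> [Y1t FC] b /=; rewrite !inE; case: eqVneq => [_|_ /=] //.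
    by move=> /FC.
  move=> Ft; split; first by have := Ft a; rewrite /= eqxx; apply; rewrite setU11.
  move=> b /= bC; have := Ft b; rewrite /= setU1r //.
  by case: eqVneq bC aC => [->->|_ _ _] //; apply.
Qed.

End Odot.

Section SingleCoalitionFirstNeighborhood.
Variables (AP : countType) (AG : finType).

Record scn_model : Type := SCNModel {
  scn_state : Type;
  scn_suc : scn_state -> set scn_state;
  scn_nei1 : AG -> scn_state -> set (set scn_state);
  scn_lab : scn_state -> set AP;
  scn_state_inh : inhabited scn_state;
  scn_nei1_cover : forall (a : AG) (s : scn_state),
    \bigcup_(Y in scn_nei1 a s) Y = scn_suc s;
  scn_nei1_neq0 : forall (a : AG) (s : scn_state), ~ scn_nei1 a s set0 }.

Definition scn_nei (M : scn_model) (C : {set AG}) (s : scn_state M) :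
    set (set (scn_state M)) :=
  [set Y | scn_suc s <> set0 /\
     (if C == finset.set0 then [set scn_suc s]
      else bigodot C (fun a => scn_nei1 a s)) Y].

Fixpoint scn_sat (M : scn_model) (phi : formula AP AG) (s : scn_state M) :
    Prop :=
  match phi with
  | FTop => True
  | FAtom p => scn_lab s p
  | FNeg psi => ~ scn_sat psi s
  | FAnd psi chi => scn_sat psi s /\ scn_sat chi s
  | FCan C psi => exists Y : set (scn_state M),
      scn_nei C s Y /\ forall t, Y t -> scn_sat psi t
  end.

Definition scn_serial (M : scn_model) : Prop :=
  forall (C : {set AG}) (s : scn_state M), scn_nei C s !=set0.

Definition scn_independent (M : scn_model) : Prop :=
  forall (s : scn_state M) (C D : {set AG}), [disjoint C & D]%B ->
  forall Y1 Y2 : set (scn_state M),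
    scn_nei C s Y1 -> scn_nei D s Y2 -> Y1 `&` Y2 !=set0.

Definition scn_deterministic (M : scn_model) : Prop :=
  forall (s : scn_state M) (Y : set (scn_state M)),
    scn_nei [set: AG]%SET s Y -> exists t, Y = [set t].

Definition scn_feature (M : scn_model) (f : feature) : Prop :=
  match f with
  | Ser => scn_serial M
  | Ind => scn_independent M
  | Det => scn_deterministic M
  end.

Definition scn_X_model (X : seq feature) (M : scn_model) : Prop :=
  forall f, f \in X -> scn_feature M f.

Definition scn_clear (M : scn_model) : Prop :=
  forall (a : AG) (s : scn_state M), partition (scn_nei1 a s) id (scn_suc s).

Definition scn_history (M : scn_model) (C : {set AG}) :
    scn_state M -> seq (set (scn_state M) * scn_state M) ->
    scn_state M -> Prop :=
  is_history (fun (s : scn_state M) Y t => scn_nei C s Y /\ Y t).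

Definition scn_tree_like (M : scn_model) : Prop :=
  exists r : scn_state M, forall (a : AG) (s : scn_state M),
    exists! h, scn_history [set a]%SET r h s.

Definition scn_valid (K : scn_model -> Prop) (phi : formula AP AG) : Prop :=
  forall M, K M -> forall s : scn_state M, scn_sat phi s.

End SingleCoalitionFirstNeighborhood.

(* Main.v *)
(** Tree-like models of both kinds are clear, so it suffices to close the cycle
    by turning a countermodel of one kind into one of the next:
    - an s-c-f action model is a g-c-f action model with the same derived
      outcomes, as the outcomes of each single agent cover the successors;
    - an s-c-f neighborhood model is an s-c-f action model whose actions are the
      sets of states, a set being available to an agent when it is one of its
      neighborhoods;
    - a tree-like (hence clear) g-c-f action model yields a tree-like s-c-f
      neighborhood model, whose neighborhoods are the nonempty outcomes: by
      clearness, the outcome of a coalition is the intersection of the outcomes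
      of its members;
    - a g-c-f action model unravels into a tree-like one, whose states are the
      AG-histories; the last-state map is a bounded morphism, injective on each
      outcome of the grand coalition, so determinism is preserved as well. *)
Require Import Defs.
From mathcomp Require Import all_boot.
From mathcomp Require Import boolp classical_sets.
Set Implicit Arguments.
Unset Strict Implicit.
Unset Printing Implicit Defensive.
Local Open Scope classical_set_scope.

(** The branches of the [match] in [ja_union] depend on the membership proof. Stating the case
    analysis for an arbitrary [q] avoids dependent rewriting. *)
Lemma alt_spec_match (P : Prop) (b c : bool) (q : alt_spec P b c) (T : Type)
    (u : P -> T) (v : ~~ b -> T) (w : T) :
  (forall p, u p = w) -> (forall n, v n = w) ->
  match q with AltTrue p => u p | AltFalse n => v n end = w.
Proof. by case: q. Qed.

(** * Joint actions as restrictions of total profiles *)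

Section JointActionOfProfile.
Variables (AG : finType) (AC : Type).
Implicit Types (C D : {set AG}) (f g : AG -> AC).

(** The types [JA AC C] vary with [C]. Total profiles do not, so restriction, union and agreement on
    a coalition become pointwise conditions on functions. *)
Definition ja_of f C : JA AC C := [ffun x : {a : AG | a \in C} => f (val x)].

Lemma ja_ofP C (sigma : JA AC C) : inhabited AC -> exists f, sigma = ja_of f C.
Proof.
move=> [c].
exists (fun a => if insub a is Some x then sigma x else c).
by apply/ffunP => x; rewrite ffunE valK.
Qed.

Lemma eq_ja_of f g C : ja_of f C = ja_of g C <-> {in C, f =1 g}.
Proof.
split=> [/ffunP fg a aC|fg].
  by have := fg (exist _ a aC); rewrite !ffunE.
by apply/ffunP => x; rewrite !ffunE; apply: fg; apply: valP.
Qed.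

Lemma restr_ja_of f C D (DC : D \subset C) : restr DC (ja_of f C) = ja_of f D.
Proof. by apply/ffunP => x; rewrite !ffunE. Qed.

Lemma ja_union_ja_of f g C D :
  ja_union (ja_of f C) (ja_of g D) =
  ja_of (fun a => if a \in C then f a else g a) (C :|: D).
Proof.
apply/ffunP => x; rewrite !ffunE.
by apply: alt_spec_match => aC; rewrite ffunE /= ?aC ?(negbTE aC).
Qed.

End JointActionOfProfile.

(** * Histories of a labelled transition relation *)

Section Histories.
Variables (ST L : Type).
Implicit Types (step : ST -> L -> ST -> Prop).

Lemma is_history_rcons step s h l t s' :
  is_history step s (rcons h (l, t)) s' <->
  exists u, [/\ is_history step s h u, step u l t & t = s'].
Proof.
elim: h s => [|[l1 s1] h IH] s /=.
  by split=> [[st <-]|[u [-> st <-]]] //; exists s.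
rewrite IH; split=> [[st [u [hu ul e]]]|[u [[st hu] ul e]]]; first by exists u.
by split=> //; exists u.
Qed.

Lemma is_history_relabel (L' : Type) (step' : ST -> L' -> ST -> Prop) step r h s :
  (forall u l t, step u l t -> exists l', step' u l' t) ->
  is_history step r h s ->
  exists2 h', is_history step' r h' s & map snd h' = map snd h.
Proof.
move=> lift; elim: h r => [|[l t] h IH] r /=; first by exists [::].
move=> [/lift[l' st] /IH[h' hh' <-]]; by exists ((l', t) :: h').
Qed.

Lemma is_history_states_inj step r h h' s :
  (forall u l l' t, step u l t -> step u l' t -> l = l') ->
  is_history step r h s -> is_history step r h' s ->
  map snd h = map snd h' -> h = h'.
Proof.
move=> inj; elim: h h' r => [[]//|[l t] h IH [//|[l' t'] h'] r] /=.
move=> [st hh] [st' hh'] [et eh]; rewrite -et in st' hh' *.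
by rewrite (inj _ _ _ _ st st') (IH _ _ hh hh' eh).
Qed.

End Histories.

(** Relabelling keeps the sequence of states. Two [step'] histories to [s] relabel to the same
    [step] history, so they visit the same states, and by [inj] these determine the labels. *)
Lemma unique_history_relabel (ST L L' : Type) (step : ST -> L -> ST -> Prop)
    (step' : ST -> L' -> ST -> Prop) r s :
  (forall u l t, step u l t -> exists l', step' u l' t) ->
  (forall u l' t, step' u l' t -> exists l, step u l t) ->
  (forall u l1 l2 t, step' u l1 t -> step' u l2 t -> l1 = l2) ->
  (exists! h, is_history step r h s) -> exists! h, is_history step' r h s.
Proof.
move=> to from inj [h [hh uniqh]].
have [h' hh' _] := is_history_relabel to hh.
exists h'; split=> // k' hk'; apply: (is_history_states_inj inj hh' hk').
have [h1 /uniqh <- <-] := is_history_relabel from hh'.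
by have [k1 /uniqh <- <-] := is_history_relabel from hk'.
Qed.

(** * Unravelling of a labelled transition relation *)

Section Unravelling.
Variables (ST L : Type) (step : ST -> L -> ST -> Prop) (r : ST).
Implicit Types (h : seq (L * ST)).

Definition endpoint h : ST := last r (map snd h).

(** The end is computed from the list instead of being stored, so by proof irrelevance a path is
    determined by its list. *)
Definition path_from : Type := {h | is_history step r h (endpoint h)}.

Definition path_end (w : path_from) : ST := endpoint (proj1_sig w).

Definition path_step (w : path_from) (l : L) (w' : path_from) : Prop :=
  exists t, step (path_end w) l t /\ proj1_sig w' = rcons (proj1_sig w) (l, t).

Definition mk_path h (p : is_history step r h (endpoint h)) : path_from :=
  exist _ h p.

Definition path_nil : path_from := mk_path (erefl : is_history step r [::] r).

Lemma path_from_inj (w w' : path_from) : proj1_sig w = proj1_sig w' -> w = w'.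
Proof. by case: w w' => [h p] [h' p'] /= e; apply: eq_exist. Qed.

Lemma endpoint_rcons h l t : endpoint (rcons h (l, t)) = t.
Proof. by rewrite /endpoint map_rcons last_rcons. Qed.

Lemma is_history_endpoint h s : is_history step r h s -> s = endpoint h.
Proof.
case/lastP: h => [//|h [l t]] /is_history_rcons[u [_ _ <-]].
by rewrite endpoint_rcons.
Qed.

Lemma path_step_lift (w : path_from) l t : step (path_end w) l t ->
  exists2 w', path_step w l w' & path_end w' = t.
Proof.
case: w => h p st.
have q : is_history step r (rcons h (l, t)) (endpoint (rcons h (l, t))).
  by apply/is_history_rcons; rewrite endpoint_rcons; exists (endpoint h).
exists (mk_path q); first by exists t.
exact: endpoint_rcons.
Qed.

Lemma path_step_end (w w' : path_from) l :
  path_step w l w' -> step (path_end w) l (path_end w').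
Proof. by move=> [t [st e]]; rewrite {2}/path_end e endpoint_rcons. Qed.

Lemma path_step_inj (w w1 w2 : path_from) l :
  path_step w l w1 -> path_step w l w2 -> path_end w1 = path_end w2 -> w1 = w2.
Proof.
move=> [t1 [_ e1]] [t2 [_ e2]]; rewrite /path_end e1 e2 !endpoint_rcons => e.
by apply: path_from_inj; rewrite e1 e2 e.
Qed.

(** Induction on the list from its end: the last step of a history to [w] must append the last entry
    of [w], which fixes both its label and its predecessor. *)
Lemma path_history_unique (w : path_from) :
  exists! H, is_history path_step path_nil H w.
Proof.
case: w => h; elim/last_ind: h => [|h [l t] IH] p.
  exists [::]; split; first exact: path_from_inj.
  (* A step ends at a nonempty list, so no nonempty history reaches the empty path. *)
  case/lastP => [//|H [l w]] /is_history_rcons[u [_ [t [_ e]] ew]].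
  by move: e; rewrite ew /=; case: (proj1_sig u).
have [u [hu st _]] : exists u, [/\ is_history step r h u, step u l t & t = t].
  by move: (p) => /is_history_rcons[u [hu st _]]; exists u.
have ue := is_history_endpoint hu; rewrite ue in hu st.
have [H [hH uniqH]] := IH hu.
exists (rcons H (l, mk_path p)); split.
  by apply/is_history_rcons; exists (mk_path hu); split=> //; exists t.
case/lastP => [|H' [l' w]].
  by move=> /= /(congr1 (size \o @proj1_sig _ _)); rewrite /= size_rcons.
move=> /is_history_rcons[v [hv [t' [_ e]] ew]].
move: e; rewrite ew => /= /rcons_inj e'; have eh := congr1 fst e'.
have el : l = l' by have /(congr1 fst) := congr1 snd e'.
have ev : v = mk_path hu by apply: path_from_inj; apply: esym eh.
by rewrite ev in hv; rewrite -el (uniqH H' hv).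
Qed.

End Unravelling.

(** * Bounded morphisms of action models *)

Section BoundedMorphism.
Variables (AP : countType) (AG : finType) (ST ST' AC : Type).
Variables (out : forall C : {set AG}, ST -> JA AC C -> set ST).
Variables (out' : forall C : {set AG}, ST' -> JA AC C -> set ST').
Variables (lab : ST -> set AP) (f : ST' -> ST).
(** The two inclusions are the back and forth conditions of a bounded morphism. *)
Hypothesis out_image : forall (C : {set AG}) s (sigma : JA AC C),
  out (f s) sigma = f @` out' s sigma.

Lemma act_av_image C s (sigma : JA AC C) :
  act_av out (f s) sigma <-> act_av out' s sigma.
Proof.
rewrite /act_av /= out_image; split=> [[_ [t ? _]]|[t ?]]; first by exists t.
by exists (f t), t.
Qed.

Lemma act_sat_image (phi : formula AP AG) s :
  act_sat out' (lab \o f) phi s <-> act_sat out lab phi (f s).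
Proof.
elim: phi s => [|p|phi IH|phi IH1 psi IH2|C phi IH] s //=.
- by rewrite IH.
- by rewrite IH1 IH2.
- split=> -[sigma [/act_av_image av H]]; exists sigma; split=> // t.
    by rewrite out_image => -[u ut <-]; apply/IH/H.
  by move=> ut; apply/IH/H; rewrite out_image; exists t.
Qed.

(** Seriality and independence speak of availability only, which [f] preserves and reflects. For
    determinism, an outcome whose image is a singleton is itself a singleton, by injectivity on
    outcomes. *)
Lemma act_feature_image :
  (forall s (sigma : JA AC [set: AG]%SET) t u,
     out' s sigma t -> out' s sigma u -> f t = f u -> t = u) ->
  forall x, act_feature out x -> act_feature out' x.
Proof.
move=> inj [] /=.
- by move=> H C s; have [sigma] := H C (f s); exists sigma; apply/act_av_image.
- move=> H s C D CD sigma tau /act_av_image a1 /act_av_image a2.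
  exact/act_av_image/H.
- move=> H s sigma av; have [u ou] : exists u, out (f s) sigma = [set u].
    exact/H/act_av_image.
  have [t ot] := av; exists t; apply/seteqP; split=> [v ov|v ->//].
  apply: (inj _ _ _ _ ov ot).
  have im w : out' s sigma w -> f w = u.
    move=> ow; have : out (f s) sigma (f w) by rewrite out_image; exists w.
    by rewrite ou.
  by rewrite (im _ ov) (im _ ot).
Qed.

End BoundedMorphism.

(** * Grand-coalition-first models and their unravelling *)

Section GrandCoalition.
Variables (AP : countType) (AG : finType).
Implicit Types (M : gca_model AP AG) (C : {set AG}).

Lemma gca_outE M (f : AG -> gca_action M) C (s t : gca_state M) :
  gca_out s (ja_of f C) t <->
  exists g, {in C, f =1 g} /\ gca_outAG s (ja_of g [set: AG]%SET) t.
Proof.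
split=> [[tau /= e st]|[g [fg st]]].
  have [g tauE] := ja_ofP tau (gca_action_inh M).
  exists g; rewrite -tauE; split=> //.
  by apply/eq_ja_of; rewrite -e tauE restr_ja_of.
exists (ja_of g [set: AG]%SET) => //=.
by rewrite restr_ja_of; apply/esym/eq_ja_of.
Qed.

Lemma gca_outT M (s : gca_state M) (sigma : JA (gca_action M) [set: AG]%SET) :
  gca_out s sigma = gca_outAG s sigma.
Proof.
have [f ->] := ja_ofP sigma (gca_action_inh M).
apply/seteqP; split=> t; last by move=> st; apply/gca_outE; exists f.
by move=> /gca_outE[g [/eq_ja_of->]].
Qed.

Lemma gca_historyE M :
  act_history (@gca_out AP AG M) (C := [set: AG]%SET) =
  is_history (fun s sigma t => gca_outAG s sigma t).
Proof.
congr is_history; apply/funext => s; apply/funext => sigma; apply/funext => t.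
rewrite /act_av /= gca_outT; apply/propext; split=> [[]//|st].
by split=> //; exists t.
Qed.

Definition gca_suc M (s : gca_state M) : set (gca_state M) :=
  [set t | exists tau, gca_outAG s tau t].

(** If [t] were an outcome of two joint actions at [s], appending either step to the history of [s]
    would give a history of [t]; uniqueness identifies the last labels. *)
Lemma gca_tree_like_clear M : gca_tree_like M -> gca_clear M.
Proof.
move=> [r tree] s sigma tau neq; rewrite -subset0 => t [st tt]; apply: neq.
have [h [hs _]] := tree s; have [k [_ uniqk]] := tree t.
move: hs uniqk; rewrite gca_historyE => hs uniqk.
have ext l : gca_outAG s l t -> k = rcons h (l, t).
  by move=> sl; apply: uniqk; apply/is_history_rcons; exists s.
have := ext _ st; rewrite (ext _ tt) => /rcons_inj/(congr1 snd)/(congr1 fst).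
exact: esym.
Qed.

Definition gca_step M (s : gca_state M) sigma (t : gca_state M) : Prop :=
  gca_outAG s sigma t.

Definition gca_unravelling M (r : gca_state M) : gca_model AP AG :=
  @GCAModel AP AG (path_from (@gca_step M) r) (gca_action M)
    (fun w sigma => path_step w sigma) (@gca_lab AP AG M \o @path_end _ _ _ r)
    (inhabits (path_nil _ r)) (gca_action_inh M).

Lemma gca_unravelling_out M (r : gca_state M) C (w : gca_state (gca_unravelling r))
    (sigma : JA (gca_action M) C) :
  gca_out (path_end w) sigma =
  @path_end _ _ _ r @` gca_out (M := gca_unravelling r) w sigma.
Proof.
apply/seteqP; split=> t.
  move=> [tau e st]; have [w' ww' <-] := @path_step_lift _ _ _ r w tau t st.
  by exists w' => //; exists tau.
by move=> [w' [tau e ww'] <-]; exists tau => //; apply: (path_step_end ww').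
Qed.

Lemma gca_unravelling_sat M (r : gca_state M) phi
    (w : gca_state (gca_unravelling r)) :
  gca_sat phi w <-> gca_sat phi (path_end w).
Proof. exact/act_sat_image/gca_unravelling_out. Qed.

Lemma gca_unravelling_X_model M (r : gca_state M) X :
  gca_X_model X M -> gca_X_model X (gca_unravelling r).
Proof.
move=> XM x xX; apply: (act_feature_image (@gca_unravelling_out M r)); last exact: XM.
(* Two extensions of [w] by the same joint action with the same end are the same list. *)
move=> w sigma t u; rewrite !gca_outT; exact: path_step_inj.
Qed.

Lemma gca_unravelling_tree_like M (r : gca_state M) :
  gca_tree_like (gca_unravelling r).
Proof.
exists (path_nil _ r) => w; rewrite gca_historyE; exact: path_history_unique.
Qed.

End GrandCoalition.

(** * From single-coalition-first to grand-coalition-first action models *)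

Section SingleCoalitionAction.
Variables (AP : countType) (AG : finType) (M : sca_model AP AG).
Implicit Types (s t : sca_state M) (C D : {set AG}).
Local Notation AC := (sca_action M).

Lemma sca_outE (f : AG -> AC) C s :
  sca_out s (ja_of f C) = if C == finset.set0 then sca_suc s
    else \bigcap_(a in [set` C]) sca_out1 s (ja_of f [set a]%SET).
Proof.
rewrite /sca_out; case: eqP => // _; apply/seteqP; split=> t /= H a.
  move=> aC; have aC' : [set a]%SET \subset C by rewrite finset.sub1set.
  by have := H a aC'; rewrite restr_ja_of.
by move=> aC; rewrite restr_ja_of; apply: H; rewrite /= -finset.sub1set.
Qed.

Lemma sca_out_suc C s (sigma : JA AC C) : sca_out s sigma `<=` sca_suc s.
Proof.
have [f ->] := ja_ofP sigma (sca_action_inh M).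
rewrite sca_outE; case: (set_0Vmem C) => [->|[a aC]]; first by rewrite eqxx.
rewrite ifN; last by apply/finset.set0Pn; exists a.
by move=> t H; rewrite -(sca_out1_suc a); exists (ja_of f [set a]%SET) => //; apply: H.
Qed.

(** The conjunct [sca_suc s t] absorbs the special case of the empty coalition; for other coalitions
    it follows from the cover condition. *)
Lemma sca_out_memE (f : AG -> AC) C s t :
  sca_out s (ja_of f C) t <->
  sca_suc s t /\ forall a, a \in C -> sca_out1 s (ja_of f [set a]%SET) t.
Proof.
split=> [H|[st H]].
  split=> [|a aC]; first exact: sca_out_suc H.
  move: H; rewrite sca_outE ifN; first exact.
  by apply/finset.set0Pn; exists a.
by rewrite sca_outE; case: ifP => // _ a; apply: H.
Qed.

(** This turns independence of actions, the availability of a union, into the nonempty intersections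
    required of neighborhoods. *)
Lemma sca_out_union s C D (sigma : JA AC C) (tau : JA AC D) :
  [disjoint C & D]%B ->
  sca_out s (ja_union sigma tau) = sca_out s sigma `&` sca_out s tau.
Proof.
move=> CD; have [f ->] := ja_ofP sigma (sca_action_inh M).
have [g ->] := ja_ofP tau (sca_action_inh M).
set h := fun a => if a \in C then f a else g a.
have hf a : a \in C -> ja_of h [set a]%SET = ja_of f [set a]%SET.
  by move=> aC; apply/eq_ja_of => b; rewrite inE /h => /eqP->; rewrite aC.
have hg a : a \in D -> ja_of h [set a]%SET = ja_of g [set a]%SET.
  move=> aD; apply/eq_ja_of => b; rewrite inE /h => /eqP->.
  by rewrite (disjointFl CD aD).
rewrite ja_union_ja_of -/h; apply/seteqP; split=> t.
  move=> /sca_out_memE[st H]; split; apply/sca_out_memE; split=> // a aCD.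
    by rewrite -hf //; apply: H; rewrite inE aCD.
  by rewrite -hg //; apply: H; rewrite inE aCD orbT.
move=> [/sca_out_memE[st H] /sca_out_memE[_ K]]; apply/sca_out_memE; split=> // a.
by rewrite inE => /orP[aC|aD]; [rewrite hf //; apply: H|rewrite hg //; apply: K].
Qed.

Definition gca_of_sca : gca_model AP AG :=
  @GCAModel AP AG (sca_state M) AC (fun s sigma => sca_out s sigma)
    (@sca_lab _ _ M) (sca_state_inh M) (sca_action_inh M).

(* A successor in the outcome of a joint action of [C] lies in the outcome of
   some action of each agent outside [C], since these outcomes cover [suc]. *)
Lemma gca_of_sca_out C s (sigma : JA AC C) :
  gca_out (M := gca_of_sca) s sigma = sca_out s sigma.
Proof.
have [f ->] := ja_ofP sigma (sca_action_inh M).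
apply/seteqP; split=> t.
  move=> /gca_outE[g [fg /sca_out_memE[st H]]]; apply/sca_out_memE; split=> // a aC.
  suff -> : ja_of f [set a]%SET = ja_of g [set a]%SET by apply: H; rewrite inE.
  by apply/eq_ja_of => b; rewrite inE => /eqP->; apply: fg.
move=> /sca_out_memE[st H].
have ext a : exists c, sca_out1 s (ja_of (fun=> c) [set a]%SET) t /\
    (a \in C -> f a = c).
  case: (boolP (a \in C)) => aC.
    exists (f a); split=> //; have := H a aC; congr (sca_out1 _ _ _).
    by apply/eq_ja_of => b; rewrite inE => /eqP->.
  move: (st); rewrite -(sca_out1_suc a) => -[tau _ stau].
  have [g tauE] := ja_ofP tau (sca_action_inh M); exists (g a); split=> //.
  move: stau; rewrite tauE; congr (sca_out1 _ _ _).
  by apply/eq_ja_of => b; rewrite inE => /eqP->.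
have [g gP] := choice ext; apply/gca_outE; exists g; split.
  by move=> a aC; apply: (gP a).2.
apply/sca_out_memE; split=> // a _; have [+ _] := gP a.
by congr (sca_out1 _ _ _); apply/eq_ja_of => b; rewrite inE => /eqP->.
Qed.

(** Both models share states, actions and labels, so equality of the outcome families transfers
    truth and all features by rewriting. *)
Lemma gca_of_sca_outE : @gca_out AP AG gca_of_sca = @sca_out AP AG M.
Proof.
apply/functional_extensionality_dep => C; apply/funext => s.
by apply/funext => sigma; apply: gca_of_sca_out.
Qed.

Lemma gca_of_sca_sat phi s :
  gca_sat (M := gca_of_sca) phi s <-> sca_sat phi s.
Proof. by rewrite /gca_sat gca_of_sca_outE. Qed.

Lemma gca_of_sca_X_model X : sca_X_model X M -> gca_X_model X gca_of_sca.
Proof. by rewrite /gca_X_model gca_of_sca_outE. Qed.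

End SingleCoalitionAction.

(** * Matching action and neighborhood models over the same states *)

Section ActionNeighborhood.
Variables (AP : countType) (AG : finType) (ST AC : Type).
Variables (suc : ST -> set ST) (lab : ST -> set AP).
Variable out1 : forall a : AG, ST -> JA AC [set a]%SET -> set ST.
Variable nei1 : AG -> ST -> set (set ST).
Hypotheses (iST : inhabited ST) (iAC : inhabited AC).
Hypothesis out1_suc : forall a s,
  \bigcup_(sigma in [set: JA AC [set a]%SET]) out1 s sigma = suc s.
Hypothesis nei1_cover : forall a s, \bigcup_(Y in nei1 a s) Y = suc s.
Hypothesis nei1_neq0 : forall a s, ~ nei1 a s set0.
(** Only this link between neighborhoods and outcomes of single agents is assumed, so that the
    section serves both for actions built from neighborhoods and for neighborhoods built from
    actions. *)
Hypothesis nei1E : forall a s Y,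
  nei1 a s Y <-> Y !=set0 /\ exists sigma, @out1 a s sigma = Y.

Let M : sca_model AP AG := SCAModel lab iST iAC out1_suc.
Let N : scn_model AP AG := SCNModel lab iST nei1_cover nei1_neq0.

Lemma scn_neiE C s Y :
  scn_nei (M := N) C s Y <->
  exists2 sigma, act_av (@sca_out AP AG M) s sigma &
                 sca_out (M := M) (C := C) s sigma = Y.
Proof.
split=> [[/eqP/set0P suc0]|[sigma av <-]].
  case: ifP => [C0 ->|C0 [Y0 [F [FC YE]]]].
    have [c] := iAC; exists (ja_of (fun=> c) C); rewrite /act_av /= sca_outE C0 //.
  (* Outside [C] any action will do, and [iAC] supplies one. *)
  have ext a : exists c, a \in C -> out1 s (ja_of (fun=> c) [set a]%SET) = F a.
    case: (boolP (a \in C)) => [/FC/nei1E[_ [sigma <-]]|_].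
      have [f ->] := ja_ofP sigma iAC; exists (f a) => _; congr (out1 _ _).
      by apply/eq_ja_of => b; rewrite inE => /eqP->.
    by have [c] := iAC; exists c.
  have [f fP] := choice ext.
  have fY : sca_out (M := M) s (ja_of f C) = Y.
    rewrite sca_outE C0 YE; apply: eq_bigcapr => a aC; rewrite -fP //=.
    by congr (out1 _ _); apply/eq_ja_of => b; rewrite inE => /eqP->.
  by exists (ja_of f C); rewrite /act_av /= ?fY.
move: (av) => [t st]; split.
  by apply/eqP/set0P; exists t; apply: (sca_out_suc st).
move: av st; have [f ->] := ja_ofP sigma iAC.
rewrite /act_av /= sca_outE; case: ifP => // C0 av st; split=> //.
exists (fun a => out1 s (ja_of f [set a]%SET)); split=> // a aC.
by apply/nei1E; split; [exists t; apply: st|exists (ja_of f [set a]%SET)].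
Qed.

Lemma scn_sca_sat phi s : scn_sat (M := N) phi s <-> sca_sat (M := M) phi s.
Proof.
rewrite /sca_sat; elim: phi s => [|p|phi IH|phi IH1 psi IH2|C phi IH] s //=.
- by rewrite IH.
- by rewrite IH1 IH2.
- split=> [[Y [/scn_neiE[sigma av <-] H]]|[sigma [av H]]].
    by exists sigma; split=> // t /H/IH.
  exists (sca_out (M := M) s sigma); split; first by apply/scn_neiE; exists sigma.
  by move=> t /H/IH.
Qed.

Lemma scn_sca_feature x :
  scn_feature N x <-> act_feature (@sca_out AP AG M) x.
Proof.
case: x => /=; split=> H.
- by move=> C s; have [Y /scn_neiE[sigma av _]] := H C s; exists sigma.
- move=> C s; have [sigma av] := H C s.
  by exists (sca_out (M := M) s sigma); apply/scn_neiE; exists sigma.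
- move=> s C D CD sigma tau a1 a2; rewrite /act_av /= sca_out_union //.
  by apply: (H s C D CD); apply/scn_neiE; [exists sigma|exists tau].
- move=> s C D CD _ _ /scn_neiE[sigma a1 <-] /scn_neiE[tau a2 <-].
  by have := H s C D CD sigma tau a1 a2; rewrite /act_av /= sca_out_union.
- by move=> s sigma av; apply: (H s); apply/scn_neiE; exists sigma.
- by move=> s _ /scn_neiE[sigma av <-]; apply: H.
Qed.

End ActionNeighborhood.

(** * From neighborhood models to single-coalition-first action models *)

Section NeighborhoodToAction.
Variables (AP : countType) (AG : finType) (N : scn_model AP AG).
Implicit Types (s : scn_state N) (a : AG).

Definition nei_out1 a s (sigma : JA (set (scn_state N)) [set a]%SET) :
    set (scn_state N) :=
  [set t | let Y := sigma (exist _ a (set11 a)) in scn_nei1 a s Y /\ Y t].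

Lemma nei_out1_suc a s :
  \bigcup_(sigma in [set: JA (set (scn_state N)) [set a]%SET]) nei_out1 s sigma =
  scn_suc s.
Proof.
rewrite -(scn_nei1_cover a); apply/seteqP; split=> t.
  by move=> [sigma _ [nY Yt]]; exists (sigma (exist _ a (set11 a))).
by move=> [Y nY Yt]; exists (ja_of (fun=> Y) [set a]%SET) => //=; rewrite /nei_out1 /= ffunE.
Qed.

Lemma nei_out1E a s Y :
  scn_nei1 a s Y <-> Y !=set0 /\ exists sigma, @nei_out1 a s sigma = Y.
Proof.
split=> [nY|[[t Yt] [sigma YE]]].
  split; first by apply/set0P/eqP => Y0; apply: (@scn_nei1_neq0 _ _ N a s); rewrite -Y0.
  exists (ja_of (fun=> Y) [set a]%SET).
  by apply/seteqP; split=> t; rewrite /nei_out1 /= ffunE => // -[].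
(* A nonempty outcome forces the chosen set to be a neighborhood, and the outcome is then that
   set. *)
move: Yt; rewrite -YE => -[nY _].
suff <- : sigma (exist _ a (set11 a)) = nei_out1 s sigma by [].
by apply/seteqP; split=> // u [].
Qed.

Definition sca_of_scn : sca_model AP AG :=
  SCAModel (@scn_lab _ _ N) (scn_state_inh N) (inhabits set0) nei_out1_suc.

Lemma sca_of_scn_sat phi s : scn_sat phi s <-> sca_sat (M := sca_of_scn) phi s.
Proof.
(* [scn_sca_sat] speaks of a model in constructor form, so [N] is destructed, after generalizing the
   facts that mention it. *)
move: s; rewrite /sca_of_scn; move: nei_out1_suc nei_out1E.
rewrite /nei_out1; case: N => ST suc nei1 lab iST cover neq0 /= o E s.
exact: scn_sca_sat.
Qed.

Lemma sca_of_scn_X_model X : scn_X_model X N -> sca_X_model X sca_of_scn.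
Proof.
rewrite /sca_of_scn /sca_X_model /scn_X_model; move: nei_out1_suc nei_out1E.
rewrite /nei_out1; case: N => ST suc nei1 lab iST cover neq0 /= o E H x /H.
by move/scn_sca_feature; apply.
Qed.

End NeighborhoodToAction.

(** * From clear grand-coalition-first models to neighborhood models *)

Section ClearToNeighborhood.
Variables (AP : countType) (AG : finType) (M : gca_model AP AG).
Hypothesis clearM : gca_clear M.
Implicit Types (s : gca_state M) (a : AG).
Local Notation AC := (gca_action M).

Lemma gca_out1_suc a s :
  \bigcup_(sigma in [set: JA AC [set a]%SET]) gca_out s sigma = gca_suc s.
Proof.
apply/seteqP; split=> t; first by move=> [sigma _ [tau _ st]]; exists tau.
by move=> [tau st]; exists (restr (finset.subsetT _) tau) => //; exists tau.
Qed.

Definition gca_nei1 a s : set (set (gca_state M)) :=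
  [set Y | Y !=set0 /\ exists sigma : JA AC [set a]%SET, gca_out s sigma = Y].

Lemma gca_nei1_cover a s : \bigcup_(Y in gca_nei1 a s) Y = gca_suc s.
Proof.
rewrite -(gca_out1_suc a); apply/seteqP; split=> t.
  by move=> [_ [_ [sigma <-]] st]; exists sigma.
by move=> [sigma _ st]; exists (gca_out s sigma) => //; split; [exists t|exists sigma].
Qed.

Lemma gca_nei1_neq0 a s : ~ gca_nei1 a s set0.
Proof. by move=> [[]]. Qed.

Definition sca_of_gca : sca_model AP AG :=
  SCAModel (@gca_lab _ _ M) (gca_state_inh M) (gca_action_inh M) gca_out1_suc.

Definition scn_of_gca : scn_model AP AG :=
  SCNModel (@gca_lab _ _ M) (gca_state_inh M) gca_nei1_cover gca_nei1_neq0.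

Lemma gca_clear_inj s sigma tau t :
  gca_outAG s sigma t -> gca_outAG s tau t -> sigma = tau.
Proof.
move=> st tt; apply: contrapT => /(@clearM s) /seteqP[H _].
exact: (H t).
Qed.

(* By clearness, the joint actions of the grand coalition that witness the
   membership of a state in the outcomes of different agents coincide. *)
Lemma sca_of_gca_out C s (sigma : JA AC C) :
  sca_out (M := sca_of_gca) s sigma = gca_out s sigma.
Proof.
have [f ->] := ja_ofP sigma (gca_action_inh M).
apply/seteqP; split=> t.
  move=> /sca_out_memE[[tau st] H].
  have [g gE] := ja_ofP tau (gca_action_inh M); rewrite gE in st.
  apply/gca_outE; exists g; split=> // a aC.
  have /gca_outE[g' [fg' st']] := H a aC.
  have /eq_ja_of <- := gca_clear_inj st' st; last by rewrite inE.
  by apply: fg'; rewrite inE.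
move=> /gca_outE[g [fg st]]; apply/sca_out_memE; split; first by exists (ja_of g _).
move=> a aC; apply/gca_outE; exists g; split=> // b.
by rewrite inE => /eqP->; apply: fg.
Qed.

Lemma sca_of_gca_outE : @sca_out AP AG sca_of_gca = @gca_out AP AG M.
Proof.
apply/functional_extensionality_dep => C; apply/funext => s.
by apply/funext => sigma; apply: sca_of_gca_out.
Qed.

Let gca_nei1E a s Y :
  gca_nei1 a s Y <->
  Y !=set0 /\ exists sigma : JA AC [set a]%SET, gca_out s sigma = Y.
Proof. by []. Qed.

Lemma scn_of_gca_sat phi s : scn_sat (M := scn_of_gca) phi s <-> gca_sat phi s.
Proof.
rewrite /gca_sat -sca_of_gca_outE.
exact: (scn_sca_sat (gca_action_inh M) gca_out1_suc gca_nei1E).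
Qed.

Lemma scn_of_gca_X_model X : gca_X_model X M -> scn_X_model X scn_of_gca.
Proof.
move=> XM x /XM; rewrite -sca_of_gca_outE => H.
exact/(scn_sca_feature _ _ (gca_action_inh M) gca_out1_suc _ _ gca_nei1E).
Qed.

(** Steps of a single agent and of the grand coalition connect the same pairs of states. By
    clearness such a pair determines the joint action, hence the agent's neighborhood, so
    [unique_history_relabel] applies. *)
Lemma scn_of_gca_tree_like : gca_tree_like M -> scn_tree_like scn_of_gca.
Proof.
move=> [r tree]; exists r => a s; have := tree s; rewrite gca_historyE.
have neiP := @scn_neiE _ _ _ _ _ (@gca_lab _ _ M) _ _ (gca_state_inh M)
  (gca_action_inh M) gca_out1_suc gca_nei1_cover gca_nei1_neq0 gca_nei1E [set a]%SET.
have outE u (sigma : JA AC [set a]%SET) :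
  sca_out (M := sca_of_gca) u sigma = gca_out u sigma by apply: sca_of_gca_out.
apply: unique_history_relabel.
- move=> u tau t ut; exists (gca_out u (restr (finset.subsetT [set a]%SET) tau)).
  have ot : gca_out u (restr (finset.subsetT [set a]%SET) tau) t by exists tau.
  split=> //; apply/neiP; exists (restr (finset.subsetT [set a]%SET) tau) => //.
  by exists t; rewrite outE.
- by move=> u Y t [/neiP[sigma _ <-]]; rewrite outE => -[tau _ ut]; exists tau.
- move=> u Y1 Y2 t [/neiP[sigma _ <-] +] [/neiP[tau _ <-]]; rewrite !outE.
  by move=> [l1 <- u1] [l2 <- u2]; rewrite (gca_clear_inj u1 u2).
Qed.

End ClearToNeighborhood.

(** * Tree-like neighborhood models are clear *)

Section Neighborhood.
Variables (AP : countType) (AG : finType) (N : scn_model AP AG).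

Lemma scn_nei_set1 a (s : scn_state N) : scn_nei [set a]%SET s = scn_nei1 a s.
Proof.
have a0 : ([set a]%SET == finset.set0) = false.
  by apply/negbTE/finset.set0Pn; exists a; rewrite inE.
apply/seteqP; split=> Y; rewrite /scn_nei /= a0 bigodot1; try exact: scn_nei1_neq0.
  by case.
move=> nY; split=> //; apply/eqP/set0P.
have [t Yt] : Y !=set0.
  by apply/set0P/eqP => Y0; apply: (@scn_nei1_neq0 _ _ N a s); rewrite -Y0.
by exists t; rewrite -(scn_nei1_cover a); exists Y.
Qed.

(** Two neighborhoods of [a] at [s] sharing a state [t] extend the history of [s] to two histories
    of [t], so they coincide. *)
Lemma scn_tree_like_clear : scn_tree_like N -> scn_clear N.
Proof.
move=> [r tree] a s; split; first exact: scn_nei1_cover.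
  move=> Y Z /= nY nZ [t [Yt Zt]].
  have [h [hs _]] := tree a s; have [k [_ uniqk]] := tree a t.
  have ext W : scn_nei1 a s W -> W t -> k = rcons h (W, t).
    move=> nW Wt; apply: uniqk; apply/is_history_rcons; exists s; split=> //.
    by rewrite scn_nei_set1.
  have := ext _ nY Yt; rewrite (ext _ nZ Zt) => /rcons_inj/(congr1 snd)/(congr1 fst).
  exact: esym.
by move=> Y nY; apply/set0P/eqP => /= Y0; apply: (@scn_nei1_neq0 _ _ N a s); rewrite -Y0.
Qed.

End Neighborhood.

Theorem theorem7p2 (AP : countType) (AG : finType) (AG_nonempty : 0 < #|AG|)
    (X : seq feature)
    (hX : X \in [:: [::]; [:: Ser]; [:: Ind]; [:: Det];
                    [:: Ser; Ind]; [:: Ser; Det]; [:: Ind; Det];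
                    [:: Ser; Ind; Det]])
    (phi : formula AP AG) :
  [<-> gca_valid (fun M => gca_X_model X M) phi;
       sca_valid (fun M => sca_X_model X M) phi;
       scn_valid (fun M => scn_X_model X M) phi;
       gca_valid (fun M => gca_clear M /\ gca_X_model X M) phi;
       scn_valid (fun M => scn_clear M /\ scn_X_model X M) phi;
       gca_valid (fun M => gca_tree_like M /\ gca_X_model X M) phi;
       scn_valid (fun M => scn_tree_like M /\ scn_X_model X M) phi].
Proof.
have gca_sca : gca_valid (gca_X_model X) phi -> sca_valid (sca_X_model X) phi.
  by move=> V M XM s; apply/gca_of_sca_sat/V/gca_of_sca_X_model.
have sca_scn : sca_valid (sca_X_model X) phi -> scn_valid (scn_X_model X) phi.
  by move=> V N XN s; apply/sca_of_scn_sat/V/sca_of_scn_X_model.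
have scn_clear_tree :
    scn_valid (fun N => scn_clear N /\ scn_X_model X N) phi ->
    scn_valid (fun N => scn_tree_like N /\ scn_X_model X N) phi.
  by move=> V N [/scn_tree_like_clear]; auto.
have scn_gca_tree :
    scn_valid (fun N => scn_tree_like N /\ scn_X_model X N) phi ->
    gca_valid (fun M => gca_tree_like M /\ gca_X_model X M) phi.
  move=> V M [treeM XM] s; have clM := gca_tree_like_clear treeM.
  apply/(scn_of_gca_sat clM)/V; split; first exact: scn_of_gca_tree_like.
  exact: scn_of_gca_X_model.
have gca_tree :
    gca_valid (fun M => gca_tree_like M /\ gca_X_model X M) phi ->
    gca_valid (gca_X_model X) phi.
  (* The unravelling is taken at [s] itself, which is the end of the empty path. *)
  move=> V M XM s; have := V (gca_unravelling s) _ (path_nil _ s).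
  move/(_ (conj (gca_unravelling_tree_like s) (gca_unravelling_X_model s XM))).
  by move/gca_unravelling_sat.
have gca_clear_tree :
    gca_valid (fun M => gca_clear M /\ gca_X_model X M) phi ->
    gca_valid (fun M => gca_tree_like M /\ gca_X_model X M) phi.
  by move=> V M [/gca_tree_like_clear]; auto.
have gca_cl : gca_valid (gca_X_model X) phi ->
    gca_valid (fun M => gca_clear M /\ gca_X_model X M) phi.
  by move=> V M []; auto.
have scn_cl : scn_valid (scn_X_model X) phi ->
    scn_valid (fun N => scn_clear N /\ scn_X_model X N) phi.
  by move=> V N []; auto.
(* Counting from 0, the implications form the cycle 0, 1, 2, 4, 6, 5, 0, with 3 on a detour from 0
   to 5. *)
tfae; tauto.
Qed.
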